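(* Let $n\ge 1$, let $F$ be a field, let $S=F[x_1,\ldots,x_n,y_1,\ldots,y_n]$, and let $K_n$ be the complete graph on the vertex set $[n]=\{1,\ldots,n\}$. Let $\mathcal{I}_{K_n}=\langle x_ix_j-y_iy_j : \{i,j\}\in E(K_n)\rangle\subseteq S$ be the parity binomial edge ideal of $K_n$. Then the set $\mathcal{S}(\mathcal{I}_{K_n})$ of binomials attached to minimal paths in $K_n$, the universal Gröbner basis $\mathcal{U}(\mathcal{I}_{K_n})$, and the Graver basis $\mathrm{Gr}(\mathcal{I}_{K_n})$ coincide: $\mathcal{S}(\mathcal{I}_{K_n})=\mathcal{U}(\mathcal{I}_{K_n})=\mathrm{Gr}(\mathcal{I}_{K_n})$.
   Context: Let $G$ be a simple graph on $[n]$ with edge set $E(G)$ (here $G=K_n$). For $v,w\in[n]$ (possibly equal), a $(v,w)$-path of length $r\ge 0$ in $G$ is a sequence of vertices $v=i_0,i_1,\ldots,i_r=w$ such that $\{i_k,i_{k+1}\}\in E(G)$ for all $k=0,\ldots,r-1$; vertices may repeat. The path is odd (even) if its length $r$ is odd (even); this is its parity. The interior of a $(v,w)$-path $\pi=(i_0,\ldots,i_r)$ is the set $\mathrm{int}(\pi)=\{i_0,\ldots,i_r\}\setminus\{v,w\}$. For $k\in\mathrm{int}(\pi)$, $G[\pi\setminus\{k\}]$ denotes the induced subgraph of $G$ on the vertex set $\{i_0,\ldots,i_r\}\setminus\{k\}$. An $(i,j)$-path $\pi$ in $G$ is called minimal if (i) for no $k\in\mathrm{int}(\pi)$ is there an $(i,j)$-path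 with the same parity as $\pi$ in $G[\pi\setminus\{k\}]$; and (ii) there is no shorter $(i,j)$-path $\pi'$ in $G$ with $\mathrm{parity}(\pi')=\mathrm{parity}(\pi)$ and $\mathrm{int}(\pi')=\mathrm{int}(\pi)$. For a minimal $(i,j)$-path $\pi$: if $\pi$ is odd, put $\mathcal{S}_\pi:=\{(x_ix_j-y_iy_j)\prod_{k\in\mathrm{int}(\pi)}t_k : t_k\in\{x_k,y_k\}\}\cup\{(y_iy_j-x_ix_j)\prod_{k\in\mathrm{int}(\pi)}t_k : t_k\in\{x_k,y_k\}\}$; if $\pi$ is even, put $\mathcal{S}_\pi:=\{(x_iy_j-y_ix_j)\prod_{k\in\mathrm{int}(\pi)}t_k : t_k\in\{x_k,y_k\}\}$. Then $\mathcal{S}(\mathcal{I}_G):=\bigcup_\pi\mathcal{S}_\pi\setminus\{0\}$, where $\pi$ runs over all minimal paths in $G$. A binomial means a nonzero difference $m-m'$ of two monic monomials of $S$. A binomial $m-m'$ in an ideal $I$ (generated by differences of monic monomials) is called primitive if there is no other binomial $p-p'\in I$ (i.e. $(p,p')\neq(m,m')$) such that $p$ divides $m$ and $p'$ divides $m'$. The Graver basis $\mathrm{Gr}(I)$ is the set of primitive binomials in $I$. The universal Gröbner basis $\mathcal{U}(I)$ is the union of all reduced Gröbner bases of $I$, over all monomial orders on $S$ (elements of a reduced Gröbner basis have leading coefficient $1$). *)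

(* Defs.v *)
From mathcomp Require Import all_boot all_order all_algebra.
From mathcomp Require Import mpoly.

Set Implicit Arguments.
Unset Strict Implicit.
Unset Printing Implicit Defensive.

Import GRing.Theory.
Local Open Scope ring_scope.

(* The vertex set [n] is 'I_n; a simple graph on it is given by its adjacency
   relation, meant to be symmetric and irreflexive, as complete_graph is. *)
Definition complete_graph (n : nat) : rel 'I_n := fun i j => i != j.

Section Paths.
Variables (n : nat) (e : rel 'I_n).
Implicit Types (v w k : 'I_n) (p q : seq 'I_n) (U : {set 'I_n}).

(* The path i_0, ..., i_r is encoded by v = i_0 and p = [:: i_1; ...; i_r], so
   that its length is size p. *)
Definition is_path U v w p : bool :=
  [&& all (fun k => k \in U) (v :: p), path e v p & last v p == w].

Definition vertices v p : {set 'I_n} := [set k in v :: p].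

Definition interior v w p : {set 'I_n} := vertices v p :\: [set v; w].

Definition same_parity p q : bool := odd (size p) == odd (size q).

Definition minimal_path v w p : Prop :=
  [/\ is_path [set: 'I_n] v w p,
      forall k, k \in interior v w p ->
        ~ exists q, is_path (vertices v p :\ k) v w q /\ same_parity q p
    & ~ exists q, [/\ is_path [set: 'I_n] v w q, (size q < size p)%N,
                      same_parity q p & interior v w q = interior v w p]].
End Paths.

Section ParityBinomials.
Variables (F : fieldType) (n : nat).
Implicit Types (e : rel 'I_n) (i j : 'I_n) (p : seq 'I_n).
Implicit Types f g : {mpoly F[n + n]}.

Definition xv i : {mpoly F[n + n]} := 'X_(lshift n i).
Definition yv i : {mpoly F[n + n]} := 'X_(rshift n i).

Definition tprod (A : {set 'I_n}) (t : {ffun 'I_n -> bool}) : {mpoly F[n + n]} :=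
  \prod_(k in A) (if t k then xv k else yv k).

Definition path_binomials i j p f : Prop :=
  exists t : {ffun 'I_n -> bool},
    let u := tprod (interior i j p) t in
    if odd (size p)
    then f = (xv i * xv j - yv i * yv j) * u \/
         f = (yv i * yv j - xv i * xv j) * u
    else f = (xv i * yv j - yv i * xv j) * u.

Definition minimal_path_binomials e f : Prop :=
  (exists i j p, minimal_path e i j p /\ path_binomials i j p f) /\ f != 0.

Definition parity_edge_generators e f : Prop :=
  exists i j, e i j /\ f = xv i * xv j - yv i * yv j.
End ParityBinomials.

Section Ideals.
Variables (F : fieldType) (N : nat).
Implicit Types (f g h : {mpoly F[N]}) (m p : 'X_{1..N}).
Implicit Types (A I : {mpoly F[N]} -> Prop) (G : seq {mpoly F[N]}).

Definition ideal_gen A f : Prop :=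
  exists s : seq ({mpoly F[N]} * {mpoly F[N]}),
    (forall q, q \in s -> A q.2) /\ f = \sum_(q <- s) q.1 * q.2.

Definition monomial_order (le : rel 'X_{1..N}) : Prop :=
  [/\ reflexive le /\ antisymmetric le, transitive le, total le,
      forall m, le 0%MM m
    & forall m p m', le m p -> le (m + m')%MM (p + m')%MM].

Definition leading_monomial (le : rel 'X_{1..N}) f m : Prop :=
  m \in msupp f /\ forall m', m' \in msupp f -> le m' m.

Definition initial_monomials (le : rel 'X_{1..N}) A f : Prop :=
  exists g m, [/\ A g, leading_monomial le g m & f = 'X_[m]].

Definition groebner_basis (le : rel 'X_{1..N}) I G : Prop :=
  (forall g, g \in G -> I g) /\
  (forall f, ideal_gen (initial_monomials le (fun g => g \in G)) f <->
             ideal_gen (initial_monomials le I) f).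

(* Here and below, (m <= m')%MM is divisibility of monomials.  Coefficient 1 at
   the leading monomial also forces elements of G to be nonzero. *)
Definition reduced_groebner_basis (le : rel 'X_{1..N}) I G : Prop :=
  [/\ groebner_basis le I G,
      forall g, g \in G -> exists m, leading_monomial le g m /\ g@_m = 1
    & forall g h m m', g \in G -> h \in G -> g != h ->
        leading_monomial le h m -> m' \in msupp g -> ~~ (m <= m')%MM].

Definition universal_groebner_basis I f : Prop :=
  exists le G, [/\ monomial_order le, reduced_groebner_basis le I G & f \in G].

Definition binomial_in I m m' : Prop :=
  m != m' /\ I ('X_[m] - 'X_[m']).

Definition primitive_binomial I m m' : Prop :=
  binomial_in I m m' /\
  ~ exists p p', [/\ binomial_in I p p', (p, p') != (m, m'),
                     (p <= m)%MM & (p' <= m')%MM].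

Definition graver_basis I f : Prop :=
  exists m m', primitive_binomial I m m' /\ f = 'X_[m] - 'X_[m'].
End Ideals.

Definition parity_edge_ideal (F : fieldType) (n : nat) (e : rel 'I_n) :
    {mpoly F[n + n]} -> Prop :=
  ideal_gen (parity_edge_generators e).

(* Main.v *)
Require Import Defs.
From mathcomp Require Import all_boot all_order all_algebra.
From mathcomp Require Import mpoly.
From mathcomp Require Import zify.

Set Implicit Arguments.
Unset Strict Implicit.
Unset Printing Implicit Defensive.

Import Order.Theory GRing.Theory.
Local Open Scope ring_scope.

(** Write z for x or y and z' for the other letter.  The binomials of a path
    depend only on its ends, parity and interior.  In a complete graph, a
    minimal path with a nonzero binomial agrees in these with a single edge, a
    path i, k, j of length two or a triangle i, k, l, i, because a further
    interior vertex could be avoided.  So the path binomials are the differences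
    p - p' for the flips
      z_i z_j -> z'_i z'_j,   z_i z'_j t_k -> z'_i z_j t_k,
      z_i^2 t_k r_l -> z'_i^2 t_k r_l,
    with distinct vertices; the relation is called flip
    (minimal_path_flip, flip_minimal_path).

    Two monomials are congruent modulo the ideal exactly when an explicit
    invariant mnm_inv agrees on them: the multidegree, the parity of the
    y-degree and, for monomials on at most two vertices, one more number.
    The invariant is constant under the generators, hence the coefficients of a
    polynomial of the ideal sum to zero over each of its fibres
    (class_sum_parity).  Conversely, if two distinct monomials m, m' have the
    same invariant, then some flip p -> p' satisfies p | m, p' | m' and brings m
    closer to m' (exists_conformal_flip), so that flips connect m with m'.  The
    same lemma shows that a primitive binomial is a flip (graver_flip).

    For every ideal whose elements never have an isolated monomial in a
    congruence class (pure_difference), the elements of a reduced Groebner basis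
    are primitive binomials (reduced_in_graver): the tail of such an element
    consists of monomials that lead no element of the ideal, and subtracting
    the binomial formed by the leading monomial and a congruent tail monomial
    leaves nothing to lead.

    It remains to see that each flip p -> p' lies in some reduced basis
    (flip_in_universal).  The ideal is homogeneous, so congruence classes are
    finite and each contains a least, standard monomial; every minimal
    nonstandard monomial has bounded degree by the covering property of flips,
    and these monomials minus their standard forms are a reduced basis
    (reduced_seq_reduced).  Hence a weight order suffices for which p' is
    standard and p divided by any variable is standard: give weight zero to one
    letter at each vertex, chosen so that p' has weight zero, and a
    suitable weight to the other letter. *)

(** * Ideals and congruence of monomials *)

Section IdealTheory.
Variables (F : fieldType) (N : nat).
Implicit Types (f g h : {mpoly F[N]}) (m p r : 'X_{1..N}).
Implicit Types (A I : {mpoly F[N]} -> Prop) (G : seq {mpoly F[N]}).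

Definition is_ideal I : Prop :=
  [/\ I 0, forall f g, I f -> I g -> I (f + g) & forall h f, I f -> I (h * f)].

Lemma is_ideal_gen A : is_ideal (ideal_gen A).
Proof.
split.
- by exists [::]; split => //; rewrite big_nil.
- move=> f g [s [As ->]] [t [At ->]]; exists (s ++ t); split=> [q|].
    by rewrite mem_cat => /orP[/As|/At].
  by rewrite big_cat.
- move=> h f [s [As ->]].
  exists [seq (h * q.1, q.2) | q <- s]; split=> [q /mapP[q' /As Aq' ->] //|].
  by rewrite big_map mulr_sumr; apply: eq_bigr => q _; rewrite mulrA.
Qed.

Lemma sub_ideal_gen A f : A f -> ideal_gen A f.
Proof.
move=> Af; exists [:: (1, f)]; split=> [q|]; first by rewrite inE => /eqP ->.
by rewrite big_seq1 mul1r.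
Qed.

Lemma ideal_gen_min A I : is_ideal I -> (forall f, A f -> I f) ->
  forall f, ideal_gen A f -> I f.
Proof.
move=> [I0 ID IM] AI f [s [As ->]]; rewrite big_seq.
by apply: (big_ind I) => // q sq; apply/IM/AI/As.
Qed.

Lemma is_idealN I f : is_ideal I -> I f -> I (- f).
Proof. by case=> _ _ IM If; rewrite -mulN1r; apply: IM. Qed.

Lemma is_idealB I f g : is_ideal I -> I f -> I g -> I (f - g).
Proof.
by move=> idI If Ig; case: (idI) => _ ID _; apply: ID If _; apply: is_idealN.
Qed.

Definition mnm_congr I m p : Prop := I ('X_[m] - 'X_[p]).

Section Congruence.
Variables (I : {mpoly F[N]} -> Prop) (idI : is_ideal I).

Lemma mnm_congr_refl m : mnm_congr I m m.
Proof. by rewrite /mnm_congr subrr; case: idI. Qed.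

Lemma mnm_congr_sym m p : mnm_congr I m p -> mnm_congr I p m.
Proof. by move=> /(is_idealN idI); rewrite opprB. Qed.

Lemma mnm_congr_trans p m q :
  mnm_congr I m p -> mnm_congr I p q -> mnm_congr I m q.
Proof.
case: idI => _ ID _ mp pq.
by have := ID _ _ mp pq; rewrite addrA subrK.
Qed.

Lemma mnm_congrD r m p : mnm_congr I m p -> mnm_congr I (m + r)%MM (p + r)%MM.
Proof.
by case: idI => _ _ IM; rewrite /mnm_congr !mpolyXD -mulrBl mulrC; apply: IM.
Qed.

End Congruence.

(** * Monomial orders and leading monomials *)

Section MonomialOrder.
Variables (le : rel 'X_{1..N}) (mo : monomial_order le).

Lemma morder_dvd m p : (m <= p)%MM -> le m p.
Proof.
case: mo => _ _ _ le0 leD /submK <-.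
by rewrite -{1}[m]add0m; apply: leD.
Qed.

Lemma morder_cancel r m p : le (m + r)%MM (p + r)%MM -> le m p.
Proof.
case: mo => -[rf asym] _ tot _ leD lemp.
case/orP: (tot m p) => // lepm; have lepm' := leD _ _ r lepm.
have /eqP : (m + r)%MM = (p + r)%MM by apply: asym; rewrite lemp.
by rewrite eqm_add2r => /eqP ->; apply: rf.
Qed.

Lemma exists_lead f : f != 0 -> exists m, leading_monomial le f m.
Proof.
case: mo => -[rf _] tr tot _ _.
rewrite -msupp_eq0 /leading_monomial; elim: (msupp f) => [//|a s IHs] _.
have [->|/IHs[m [ms lem]]] := eqVneq s [::].
  by exists a; split=> [|m']; rewrite inE // => /eqP ->.
case/orP: (tot a m) => h.
  exists m; split=> [|m']; rewrite inE ?ms ?orbT //.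
  by case/orP=> [/eqP -> //|]; apply: lem.
exists a; split=> [|m']; rewrite inE ?eqxx //.
by case/orP=> [/eqP -> //|/lem /tr]; apply.
Qed.

Lemma lead_uniq f m p :
  leading_monomial le f m -> leading_monomial le f p -> m = p.
Proof.
case: mo => -[_ asym] _ _ _ _ [mf lem] [pf lep].
by apply: asym; rewrite lep // lem.
Qed.

(** The polynomials all of whose monomials are divisible by such a leading
    monomial form an ideal, and it contains the generators. *)
Lemma supp_initial_ideal A f m :
  ideal_gen (initial_monomials le A) f -> m \in msupp f ->
  exists g p, [/\ A g, leading_monomial le g p & (p <= m)%MM].
Proof.
pose J f := forall m, m \in msupp f ->
  exists g p, [/\ A g, leading_monomial le g p & (p <= m)%MM].
suff: forall h, ideal_gen (initial_monomials le A) h -> J h by move=> H /H; apply.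
apply: ideal_gen_min; first split.
- by move=> q; rewrite msupp0.
- by move=> f1 f2 J1 J2 q /msuppD_le; rewrite mem_cat => /orP[/J1|/J2].
- move=> h f1 J1 q /msuppM_le /allpairsP[[m1 m2] /= [_ /J1 [g [p [Ag lg pm]]] ->]].
  by exists g, p; split=> //; apply: lepm_trans pm (lem_addl _ _).
- move=> _ [g [p [Ag lg ->]]] q; rewrite msuppX inE => /eqP ->.
  by exists g, p; split=> //; apply: lepm_refl.
Qed.

Lemma groebner_lead I G f m : groebner_basis le I G -> I f ->
  leading_monomial le f m ->
  exists g p, [/\ g \in G, leading_monomial le g p & (p <= m)%MM].
Proof.
move=> [_ inG] If lf; apply: (@supp_initial_ideal _ 'X_[m]).
  by apply/inG/sub_ideal_gen; exists f, m.
by rewrite msuppX inE.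
Qed.

Lemma lead_binomial m p : m != p -> le p m ->
  leading_monomial le ('X_[m] - 'X_[p] : {mpoly F[N]}) m.
Proof.
case: mo => -[rf _] _ _ _ _ mp pm; split.
  by rewrite mcoeff_msupp mcoeffB !mcoeffX eqxx (eq_sym p) (negPf mp) subr0 oner_eq0.
by move=> q /msuppB_le; rewrite !msuppX !inE => /orP[]/eqP->.
Qed.

End MonomialOrder.

Lemma binomial_neq0 m p : m != p -> 'X_[m] - 'X_[p] != 0 :> {mpoly F[N]}.
Proof.
move=> mp; apply: contraNneq mp => /(congr1 (mcoeff m)).
rewrite mcoeffB !mcoeffX eqxx mcoeff0 [p == m]eq_sym.
by case: (m == p) => //= /eqP; rewrite subr0 oner_eq0.
Qed.

Lemma congr_lead le I m p (mo : monomial_order le) : 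
  is_ideal I -> m != p -> mnm_congr I m p ->
  exists2 g, I g & leading_monomial le g m \/ leading_monomial le g p.
Proof.
move=> idI mp mIp; case: (mo) => _ _ tot _ _.
case/orP: (tot m p) => h.
  exists ('X_[p] - 'X_[m]); first exact: mnm_congr_sym.
  by right; apply: lead_binomial; rewrite // eq_sym.
by exists ('X_[m] - 'X_[p]) => //; left; apply: lead_binomial.
Qed.

(** * Reduced bases consist of primitive binomials *)

(** Equivalent to being spanned, as a vector space, by differences of
    monomials: the coefficients of an element over a congruence class sum to
    zero, so a class cannot be met exactly once. *)
Definition pure_difference I : Prop :=
  is_ideal I /\ forall f m, I f -> m \in msupp f ->
    exists m', [/\ m' \in msupp f, m' != m & mnm_congr I m m'].

Section UniversalInGraver.
Variables (I : {mpoly F[N]} -> Prop) (pdI : pure_difference I).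
Variables (le : rel 'X_{1..N}) (mo : monomial_order le).
Variables (G : seq {mpoly F[N]}) (rG : reduced_groebner_basis le I G).

(** Leading monomials of the ideal are divisible by leading monomials of the
    basis; reducedness excludes those of the other basis elements, and in the
    order nothing below the leading monomial of g is divisible by it. *)
Lemma reduced_tail_standard g m q f : g \in G -> leading_monomial le g m ->
  q \in msupp g -> I f -> leading_monomial le f q -> q = m.
Proof.
case: (mo) => -[_ asym] _ _ _ _.
case: rG => gbG _ red gG lgm qg If lfq.
have [h [p [hG lhp pq]]] := groebner_lead gbG If lfq.
have [gh|gh] := eqVneq g h; last first.
  by have := red _ _ _ _ gG hG gh lhp qg; rewrite pq.
rewrite -gh in lhp; rewrite (lead_uniq mo lhp lgm) in pq.
by apply: asym; rewrite (morder_dvd mo pq) andbT; case: lgm => _; apply.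
Qed.

(** Subtracting from g the binomial made of its leading monomial and of a
    congruent tail monomial gives an element of the ideal supported on the tail
    of g, where no monomial leads an element of the ideal. *)
Lemma reduced_is_binomial g : g \in G ->
  exists m m', [/\ leading_monomial le g m, m' \in msupp g, m != m',
                   mnm_congr I m m' & g = 'X_[m] - 'X_[m']].
Proof.
case: rG => -[GI _] mon _ gG; case: pdI => idI mate.
have [m [lgm gm1]] := mon _ gG.
have [m' [m'g m'm mIm']] := mate _ _ (GI _ gG) (proj1 lgm).
exists m, m'; split=> //; first by rewrite eq_sym.
apply/eqP; rewrite -subr_eq0; apply: contraT => /(exists_lead mo)[q lq].
have Ir : I (g - ('X_[m] - 'X_[m'])) by apply: is_idealB => //; apply: GI.
have qr := proj1 lq.
have qg : q \in msupp g.
  have [->//|qm'] := eqVneq q m'; have [->|qm] := eqVneq q m; first by case: lgm.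
  move: qr; rewrite !mcoeff_msupp !mcoeffB !mcoeffX.
  by rewrite (eq_sym m) (eq_sym m') (negPf qm) (negPf qm') !subr0.
move: qr; rewrite (reduced_tail_standard gG lgm qg Ir lq).
by rewrite mcoeff_msupp !mcoeffB !mcoeffX gm1 eqxx (negPf m'm) subr0 subrr eqxx.
Qed.

(** If p - p' lies below m - m', then p' cannot lead because m' is standard, so
    p leads and equals the minimal generator m; then p' and m' are congruent
    divisors of the standard monomial m', hence equal. *)
Lemma reduced_in_graver g : g \in G -> graver_basis I g.
Proof.
move=> gG; have [m [m' [lgm m'g mm' mIm' gE]]] := reduced_is_binomial gG.
case: pdI => idI _; case: (mo) => -[_ asym] _ _ _ _.
case: (rG) => gbG _ red.
exists m, m'; split=> //; split=> // -[p [p' [[pp' pIp'] ne pm p'm']]].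
have tail f q : I f -> leading_monomial le f q -> (q <= m')%MM -> False.
  move=> If lq qm'; have [h [r [hG lh rq]]] := groebner_lead gbG If lq.
  have rm' := lepm_trans rq qm'.
  have [gh|gh] := eqVneq g h.
    rewrite -gh in lh; rewrite (lead_uniq mo lh lgm) in rm'.
    case/negP: mm'; apply/eqP/asym.
    by rewrite (morder_dvd mo rm'); case: lgm => _; apply.
  by have := red _ _ _ _ gG hG gh lh m'g; rewrite rm'.
have [f If [lf|lf]] := congr_lead mo idI pp' pIp'; last first.
  exact: tail If lf p'm'.
have [h [r [hG lh rp]]] := groebner_lead gbG If lf.
have mp : p = m.
  have [gh|gh] := eqVneq g h; last first.
    by have := red _ _ _ _ gG hG gh lh (proj1 lgm); rewrite (lepm_trans rp pm).
  rewrite -gh in lh; rewrite (lead_uniq mo lh lgm) in rp.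
  by apply: asym; rewrite !(morder_dvd mo).
rewrite {}mp in pp' pIp' ne lf.
have ne' : p' != m' by apply: contraNneq ne => ->.
have Ip' : mnm_congr I p' m'.
  exact: (mnm_congr_trans idI (mnm_congr_sym idI pIp') mIm').
have [f' If' [lf'|lf']] := congr_lead mo idI ne' Ip'.
  exact: tail If' lf' p'm'.
exact: tail If' lf' (lepm_refl _).
Qed.

End UniversalInGraver.
End IdealTheory.

(** * Reduced bases from a covering family of moves *)

(** The relation R stands for a finite family of binomials which lies below every
    binomial of the ideal; D bounds the degrees in this family, which makes the
    reduced basis a finite list. *)
Section ReducedBasis.
Variables (F : fieldType) (N : nat).
Implicit Types (f g h : {mpoly F[N]}) (m p : 'X_{1..N}).
Variables (I : {mpoly F[N]} -> Prop) (pdI : pure_difference I).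
Variables (eqv : rel 'X_{1..N}).
Hypothesis eqvP : forall m p, reflect (mnm_congr I m p) (eqv m p).
Hypothesis eqv_mdeg : forall m p, eqv m p -> mdeg m = mdeg p.
Variables (R : 'X_{1..N} -> 'X_{1..N} -> Prop) (D : nat).
Hypothesis R_congr : forall p p', R p p' -> mnm_congr I p p'.
Hypothesis R_neq : forall p p', R p p' -> p != p'.
Hypothesis R_mdeg : forall p p', R p p' -> (mdeg p < D)%N.
Hypothesis R_cover : forall m m', mnm_congr I m m' -> m != m' ->
  exists p p', [/\ R p p', (p <= m)%MM & (p' <= m')%MM].
Variables (le : rel 'X_{1..N}) (mo : monomial_order le).

Let idI : is_ideal I. Proof. by case: pdI. Qed.
Let leT : transitive le. Proof. by case: mo. Qed.
Let le_asym : antisymmetric le. Proof. by case: mo => -[]. Qed.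
Let le_refl : reflexive le. Proof. by case: mo => -[]. Qed.
Let le_total : total le. Proof. by case: mo. Qed.

(** Congruent monomials have equal degrees, so that minimality in the congruence
    class can be tested on finitely many monomials. *)
Definition standard m : bool :=
  [forall p : 'X_{1..N < (mdeg m).+1}, eqv m p ==> le m p].

Lemma standardP m :
  reflect (forall p, mnm_congr I m p -> le m p) (standard m).
Proof.
apply: (iffP forallP) => [std p|std p]; last by apply/implyP => /eqvP /std.
move=> /eqvP mp; have dp : (mdeg p < (mdeg m).+1)%N by rewrite (eqv_mdeg mp).
by have /implyP := std (BMultinom dp); apply.
Qed.

Lemma standard_dvd p m : standard m -> (p <= m)%MM -> standard p.
Proof.
move=> /standardP std /submK pm; apply/standardP => q pq.
apply: (morder_cancel mo (r := (m - p)%MM)).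
by rewrite addmC pm; apply: std; rewrite -{1}pm addmC; apply: mnm_congrD.
Qed.

Lemma standard_uniq m p :
  mnm_congr I m p -> standard m -> standard p -> m = p.
Proof.
move=> mp /standardP ms /standardP ps; apply: le_asym.
by rewrite (ms _ mp) (ps _ (mnm_congr_sym idI mp)).
Qed.

Lemma exists_standard m : exists2 m', mnm_congr I m m' & standard m'.
Proof.
have dm : (mdeg m < (mdeg m).+1)%N by [].
have Pm : eqv m (BMultinom dm) by apply/eqvP; apply: mnm_congr_refl.
case: (@extremumP _ _ (fun a b : 'X_{1..N} => le a b)
  (BMultinom dm) (fun p : 'X_{1..N < (mdeg m).+1} => eqv m p) (@bmnm N _)
  le_refl leT le_total Pm) => /= p mp pmin.
exists p; first exact/eqvP.
apply/standardP => q pq; have mq : eqv m q.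
  by apply/eqvP/(mnm_congr_trans idI _ pq)/eqvP.
have dq : (mdeg q < (mdeg m).+1)%N by rewrite (eqv_mdeg mq).
by have := pmin (BMultinom dq) mq.
Qed.

Lemma lead_nonstandard f m :
  I f -> leading_monomial le f m -> ~~ standard m.
Proof.
move=> If [mf lem]; case: pdI => _ mate.
have [p [pf pm mp]] := mate _ _ If mf.
apply/negP => /standardP /(_ _ mp) lemp.
by case/eqP: pm; apply: le_asym; rewrite lemp lem.
Qed.

(** Otherwise a move would lead from a divisor of m to a divisor of the standard
    form of m, which is standard, and therefore would not go up. *)
Lemma standard_of_moves m :
  (forall p p', R p p' -> (p <= m)%MM -> le p p') -> standard m.
Proof.
move=> H; have [m' mm' m's] := exists_standard m.
have [->//|ne] := eqVneq m m'.
have [p [p' [Rp pm pm']]] := R_cover mm' ne.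
have /standardP p's := standard_dvd m's pm'.
case/eqP: (R_neq Rp); apply: le_asym; rewrite (H _ _ Rp pm).
exact: p's (mnm_congr_sym idI (R_congr Rp)).
Qed.

Definition min_nonstandard m : bool :=
  ~~ standard m && [forall i, (0 < m i)%N ==> standard (m - U_(i))%MM].

Lemma min_nonstandard_dvd m p :
  min_nonstandard m -> (p <= m)%MM -> ~~ standard p -> p = m.
Proof.
move=> /andP[_ /forallP mst] pm; apply: contraNeq => ne.
have [i lti] : exists i, (p i < m i)%N.
  apply/existsP; apply: contraNT ne; rewrite negb_exists => /forallP ge.
  apply/eqP/mnmP => i; apply/eqP; rewrite eqn_leq (mnm_lepP pm) /=.
  by rewrite leqNgt ge.
apply: (@standard_dvd _ (m - U_(i))%MM).
  by have /implyP := mst i; apply; apply: leq_trans lti.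
apply/mnm_lepP => j; rewrite mnmBE mnm1E.
by have := mnm_lepP pm j; case: (i =P j) => [<-|_]; lia.
Qed.

Lemma exists_min_nonstandard m :
  ~~ standard m -> exists2 p, (p <= m)%MM & min_nonstandard p.
Proof.
elim: {m}(mdeg m) {-2}m (erefl (mdeg m)) => [|d IH] m dm ms.
  exists m; first exact: lepm_refl.
  rewrite /min_nonstandard ms; apply/forallP => i; apply/implyP.
  by move/eqP: dm; rewrite mdeg_eq0 => /eqP ->; rewrite mnm0E.
case: (boolP (min_nonstandard m)) => [mm|].
  by exists m => //; apply: lepm_refl.
rewrite /min_nonstandard ms negb_forall => /existsP[i].
rewrite negb_imply => /andP[mi mst].
have Ui : (U_(i) <= m)%MM by rewrite lep1mP -lt0n.
have [|p pm pmin] := IH _ _ mst.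
  by move: dm; rewrite -{1}(submK Ui) mdegD mdeg1 addn1 => -[].
by exists p => //; apply: lepm_trans pm (lem_subr _ _).
Qed.

(** A move below m and its standard form starts at a nonstandard divisor of m,
    which is m itself by minimality. *)
Lemma min_nonstandard_mdeg m : min_nonstandard m -> (mdeg m < D)%N.
Proof.
move=> mm; have [m' mm' m's] := exists_standard m.
have ne : m != m'.
  by apply: contraTneq m's => <-; case/andP: mm.
have [p [p' [Rp pm pm']]] := R_cover mm' ne.
have p's := standard_dvd m's pm'.
suff <- : p = m by apply: R_mdeg Rp.
apply: min_nonstandard_dvd mm pm _; apply: contra (R_neq Rp) => ps.
by apply/eqP/standard_uniq => //; apply: R_congr.
Qed.

Definition reduced_pair (x : 'X_{1..N} * 'X_{1..N}) : bool :=
  [&& min_nonstandard x.1, standard x.2 & eqv x.1 x.2].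

Definition reduced_seq : seq {mpoly F[N]} :=
  [seq 'X_[x.1] - 'X_[x.2]
     | x : 'X_{1..N < D} * 'X_{1..N < D}
     in [pred x | reduced_pair (bmnm x.1, bmnm x.2)]].

Lemma mem_reduced_seq g : reflect
  (exists m m', reduced_pair (m, m') /\ g = 'X_[m] - 'X_[m'])
  (g \in reduced_seq).
Proof.
apply: (iffP imageP) => [[[m m'] /= rp ->]|[m [m' [rp ->]]]].
  by exists m, m'.
have dm : (mdeg m < D)%N by apply: min_nonstandard_mdeg; case/and3P: rp.
have dm' : (mdeg m' < D)%N by case/and3P: rp => _ _ /eqv_mdeg <-.
by exists (BMultinom dm, BMultinom dm').
Qed.

Lemma lead_reduced_pair m m' : reduced_pair (m, m') ->
  leading_monomial le ('X_[m] - 'X_[m'] : {mpoly F[N]}) m.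
Proof.
move=> /and3P[/= mm m's /eqvP mm']; apply: lead_binomial => //.
  by apply: contraTneq m's => <-; case/andP: mm.
by move/standardP: m's; apply; apply: mnm_congr_sym.
Qed.

Lemma reduced_seq_groebner : groebner_basis le I reduced_seq.
Proof.
have GI g : g \in reduced_seq -> I g.
  by case/mem_reduced_seq => m [m' [/and3P[_ _ /eqvP ?] ->]].
split=> // f; split; apply: ideal_gen_min; try exact: is_ideal_gen.
  move=> _ [g [m [gG lg ->]]]; apply: sub_ideal_gen.
  by exists g, m; split=> //; apply: GI.
move=> _ [g [m [Ig lg ->]]].
have [p pm pmin] := exists_min_nonstandard (lead_nonstandard Ig lg).
have [p' pp' p's] := exists_standard p.
have rp : reduced_pair (p, p') by apply/and3P; split=> //; apply/eqvP.
rewrite -(submK pm) mpolyXD.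
have [_ _] := is_ideal_gen (initial_monomials le (fun g => g \in reduced_seq)).
apply; apply: sub_ideal_gen; exists ('X_[p] - 'X_[p']), p; split=> //.
  by apply/mem_reduced_seq; exists p, p'.
exact: lead_reduced_pair.
Qed.

Lemma reduced_seq_reduced : reduced_groebner_basis le I reduced_seq.
Proof.
split; first exact: reduced_seq_groebner.
  move=> _ /mem_reduced_seq[m [m' [rp ->]]]; exists m.
  split; first exact: lead_reduced_pair.
  have [_] := lead_reduced_pair rp; case/and3P: rp => /= /andP[ms _] m's _ _.
  rewrite mcoeffB !mcoeffX eqxx; case: eqP => [mm'|]; last by rewrite subr0.
  by rewrite -mm' m's in ms.
move=> _ _ m q /mem_reduced_seq[p [p' [rp ->]]] /mem_reduced_seq[r [r' [rr ->]]].
move=> ne lr qs; rewrite (lead_uniq mo lr (lead_reduced_pair rr)).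
case/and3P: rp => /= pm p's /eqvP pp'; case/and3P: rr => /= rm r's /eqvP rr'.
have rs : ~~ standard r by case/andP: rm.
apply/negP; move/msuppB_le: qs; rewrite !msuppX !inE => /orP[]/eqP-> rq.
  have rp := min_nonstandard_dvd pm rq rs; rewrite rp in rr' ne.
  have p'r' : mnm_congr I p' r' := mnm_congr_trans idI (mnm_congr_sym idI pp') rr'.
  by case/eqP: ne; rewrite (standard_uniq p'r').
by case/negP: rs; apply: standard_dvd rq.
Qed.

(** The binomial is an entry of the reduced basis [reduced_seq]; the order only
    has to be good near the given pair. *)
Lemma binomial_in_universal m m' : mnm_congr I m m' -> m != m' ->
    standard m' -> (forall i, (0 < m i)%N -> standard (m - U_(i))%MM) ->
  universal_groebner_basis I ('X_[m] - 'X_[m']).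
Proof.
move=> mm' ne m's ms; exists le, reduced_seq; split=> //.
  exact: reduced_seq_reduced.
apply/mem_reduced_seq; exists m, m'; split=> //.
rewrite /reduced_pair /min_nonstandard m's; apply/and3P; split=> //.
  apply/andP; split.
    by apply: contra ne => mst; apply/eqP/standard_uniq.
  by apply/forallP => i; apply/implyP/ms.
exact/eqvP.
Qed.

End ReducedBasis.

(** * Flips *)

Section SignedVariables.
Variable n : nat.
Implicit Types (i j k l v : 'I_n) (s t b : bool) (m p : 'X_{1..n + n}).

(** Both letters at a vertex are handled at once: [true] stands for x and
    [false] for y. *)
Definition zvar b v : 'I_(n + n) := if b then lshift n v else rshift n v.
Arguments zvar : simpl never.
Definition zsign (x : 'I_(n + n)) : bool :=
  if split x is inl _ then true else false.
Definition zvertex (x : 'I_(n + n)) : 'I_n :=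
  match split x with inl v => v | inr v => v end.

Lemma zvarK x : zvar (zsign x) (zvertex x) = x.
Proof. by rewrite -[RHS]splitK /zvar /zsign /zvertex; case: (split x). Qed.

Lemma zsignE b v : zsign (zvar b v) = b.
Proof.
rewrite /zsign /zvar; case: b.
  by rewrite -[lshift n v]/(unsplit (inl v)) unsplitK.
by rewrite -[rshift n v]/(unsplit (inr v)) unsplitK.
Qed.

Lemma zvertexE b v : zvertex (zvar b v) = v.
Proof.
rewrite /zvertex /zvar; case: b.
  by rewrite -[lshift n v]/(unsplit (inl v)) unsplitK.
by rewrite -[rshift n v]/(unsplit (inr v)) unsplitK.
Qed.

Lemma eq_zvar s i t j : (zvar s i == zvar t j) = (s == t) && (i == j).
Proof.
apply/eqP/andP => [e|[/eqP -> /eqP ->] //].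
have /[!zsignE] -> := congr1 zsign e.
by have /[!zvertexE] -> := congr1 zvertex e.
Qed.

Lemma lem_zvarP (m p : 'X_{1..n + n}) :
  (forall b v, m (zvar b v) <= p (zvar b v))%N -> (m <= p)%MM.
Proof. by move=> E; apply/mnm_lepP => x; rewrite -(zvarK x). Qed.

Local Notation Z s i := (U_(zvar s i))%MM.

Lemma mnm1_zvar s i t j : Z s i (zvar t j) = (s == t) && (i == j) :> nat.
Proof. by rewrite mnm1E eq_zvar. Qed.

(** The monomial pairs of the binomials of the minimal paths i j, i k j and
    i k l i. *)
Inductive flip : 'X_{1..n + n} -> 'X_{1..n + n} -> Prop :=
| flip_edge s i j of i != j :
    flip (Z s i + Z s j)%MM (Z (~~ s) i + Z (~~ s) j)%MM
| flip_even s i j t k of i != j & k != i & k != j :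
    flip (Z s i + Z (~~ s) j + Z t k)%MM (Z (~~ s) i + Z s j + Z t k)%MM
| flip_odd s i t k r l of k != i & l != i & l != k :
    flip (Z s i + Z s i + (Z t k + Z r l))%MM
         (Z (~~ s) i + Z (~~ s) i + (Z t k + Z r l))%MM.

Lemma flip_neq p p' : flip p p' -> p != p'.
Proof.
case=> [s i j ij|s i j t k ij ki kj|s i t k r l ki li lk];
  apply/eqP => /mnmP /(_ (zvar s i)); rewrite !mnmDE !mnm1_zvar !eqxx.
- by case: s => /=; lia.
- by rewrite (negPf ki) [j == i]eq_sym (negPf ij); case: s; case: t.
- by rewrite (negPf ki) (negPf li); case: s; case: t; case: r.
Qed.

Lemma flip_mdeg p p' : flip p p' -> mdeg p = mdeg p' /\ (mdeg p < 5)%N.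
Proof. by case=> *; rewrite !mdegD !mdeg1. Qed.

Definition vdeg m v : nat := (m (zvar true v) + m (zvar false v))%N.
Definition ydeg_odd (m : 'X_{1..n + n}) : bool :=
  odd (\sum_(v < n) m (zvar false v)).
Definition supported_on m i j : bool :=
  [forall v, (v != i) && (v != j) ==> (vdeg m v == 0%N)].
(** On the two vertices i and j the only generator is x_i x_j - y_i y_j, which
    preserves the exponent of x_i plus that of y_j.  On a single vertex (i = j)
    there is no generator, and the exponent of x_i itself is preserved. *)
Definition local_inv m i j : nat :=
  if supported_on m i j
  then (m (zvar true i) + (i != j) * m (zvar false j))%N else 0%N.
Definition mnm_inv m :=
  ([ffun v => vdeg m v], ydeg_odd m, [ffun x => local_inv m x.1 x.2]).

Lemma mnm_invP m p : reflect
  [/\ forall v, vdeg m v = vdeg p v, ydeg_odd m = ydeg_odd p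
    & forall i j, local_inv m i j = local_inv p i j]
  (mnm_inv m == mnm_inv p).
Proof.
apply: (iffP eqP) => [[/ffunP e1 e2 /ffunP e3]|[e1 e2 e3]].
  split=> // [v|i j]; first by have := e1 v; rewrite !ffunE.
  by have := e3 (i, j); rewrite !ffunE.
congr (_, _, _) => //; first by apply/ffunP => v; rewrite !ffunE.
by apply/ffunP => x; rewrite !ffunE.
Qed.

Lemma vdegD m p v : vdeg (m + p)%MM v = (vdeg m v + vdeg p v)%N.
Proof. by rewrite /vdeg !mnmDE addnACA. Qed.

Lemma vdeg1 s i v : vdeg (Z s i) v = (i == v).
Proof. by rewrite /vdeg !mnm1_zvar; case: s => /=; rewrite ?addn0 ?add0n. Qed.

Lemma mdeg_vdeg m : mdeg m = (\sum_v vdeg m v)%N.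
Proof.
by rewrite mdegE big_split_ord /= [RHS]big_split.
Qed.

Lemma ydeg_oddD m p : ydeg_odd (m + p)%MM = ydeg_odd m (+) ydeg_odd p.
Proof.
rewrite /ydeg_odd -oddD -big_split /=; congr odd.
by apply: eq_bigr => v _; rewrite mnmDE.
Qed.

Lemma ydeg_odd1 s i : ydeg_odd (Z s i) = ~~ s.
Proof.
rewrite /ydeg_odd (bigD1 i) //= big1 ?addn0 => [|v vi].
  by rewrite mnm1_zvar eqxx; case: s.
by rewrite mnm1_zvar [i == v]eq_sym (negPf vi) andbF.
Qed.

(** The local part is preserved because an edge that touches a monomial
    supported on at most two vertices must join these two vertices. *)
Lemma mnm_inv_edge r i j : i != j ->
  mnm_inv (Z true i + Z true j + r)%MM = mnm_inv (Z false i + Z false j + r)%MM.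
Proof.
move=> ij; apply/eqP/mnm_invP; split=> [v||a b].
- by rewrite !vdegD !vdeg1.
- by rewrite !ydeg_oddD !ydeg_odd1.
have V v : vdeg (Z true i + Z true j + r)%MM v =
           vdeg (Z false i + Z false j + r)%MM v by rewrite !vdegD !vdeg1.
rewrite /local_inv; have -> : supported_on (Z true i + Z true j + r)%MM a b =
    supported_on (Z false i + Z false j + r)%MM a b.
  by apply: eq_forallb => v; rewrite V.
case: ifP => // /forallP sup.
have in_ab v : (v == i) || (v == j) -> (v == a) || (v == b).
  move=> vij; have := sup v; apply: contraLR; rewrite negb_or => -> /=.
  by rewrite !vdegD !vdeg1 -lt0n [i == v]eq_sym [j == v]eq_sym; lia.
have := in_ab i; have := in_ab j; rewrite !eqxx orbT => /(_ isT) jab /(_ isT) iab.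
rewrite !mnmDE !mnm1_zvar /= !add0n.
by case/orP: iab ij => /eqP ->; case/orP: jab => /eqP ->;
  rewrite ?eqxx ?[b == a]eq_sym; case: (a == b) => //= _; lia.
Qed.

(** Besides divisibility, the last two conditions say that replacing p by p' in
    m moves every exponent towards m' without overshooting. *)
Definition conformal (p p' m m' : 'X_{1..n + n}) : bool :=
  [&& p <= m, p' <= m', p - p' <= m - m' & p' - p <= m' - m]%MM.

Lemma conformalP p p' m m' : (forall b v, let x := zvar b v in
    [&& p x <= m x, p' x <= m' x, p x - p' x <= m x - m' x
      & p' x - p x <= m' x - m x]%N) ->
  conformal p p' m m'.
Proof.
by move=> H; apply/and4P; split; apply: lem_zvarP => b v;
  case/and4P: (H b v) => *; rewrite ?mnmBE.
Qed.

(** Let [up s v] mean that m has more of the letter s at v than m'.  As the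
    multidegrees agree, at each vertex at most one letter is up.  Two vertices
    with the same letter up give an edge flip.  Otherwise there is a vertex i
    with s up and at most one other vertex j, with the opposite letter up.  If j
    exists, the local part of the invariant forbids that m lives on i and j only,
    and a third vertex, where m and m' agree, gives the context of an even flip.
    If i is alone, parity makes the excess at i at least two, and the local part
    provides the two further vertices of an odd flip. *)
Lemma exists_conformal_flip m m' : mnm_inv m = mnm_inv m' -> m != m' ->
  exists2 x, flip x.1 x.2 & conformal x.1 x.2 m m'.
Proof.
move=> /eqP/mnm_invP[eqV eqY eqL] ne.
pose up s v := (m' (zvar s v) < m (zvar s v))%N.
have upN s v : up (~~ s) v = (m (zvar s v) < m' (zvar s v))%N.
  by have := eqV v; rewrite /vdeg /up; case: s => /=; lia.
have upP s v : up s v -> (m (zvar (~~ s) v) < m' (zvar (~~ s) v))%N.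
  by rewrite -upN negbK.
have not_up v : (forall b, ~~ up b v) ->
    forall b, m (zvar b v) = m' (zvar b v).
  move=> nu b; have := nu b; have := nu (~~ b); rewrite upN /up -!leqNgt.
  by move=> le1 le2; apply/eqP; rewrite eqn_leq le1 le2.
have edge s i j : i != j -> up s i -> up s j ->
    exists2 x, flip x.1 x.2 & conformal x.1 x.2 m m'.
  move=> ij ui uj.
  exists ((Z s i + Z s j)%MM, (Z (~~ s) i + Z (~~ s) j)%MM); first exact: flip_edge.
  apply: conformalP => b v /=; rewrite !mnmDE !mnm1_zvar.
  have ui' := upP _ _ ui; have uj' := upP _ _ uj; rewrite /up in ui uj.
  have [iv|_] := eqVneq i v; have [jv|_] := eqVneq j v.
  - by move: ij; rewrite iv jv eqxx.
  - rewrite -iv; case: s ui ui' {uj uj'}; case: b => /=; lia.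
  - rewrite -jv; case: s uj uj' {ui ui'}; case: b => /=; lia.
  - by rewrite !andbF.
have [s [i ui]] : exists s i, up s i.
  have [x xm] : exists x, m x != m' x.
    apply/existsP; apply: contraNT ne; rewrite negb_exists => /forallP H.
    by apply/eqP/mnmP => x; apply/eqP; rewrite -[_ == _]negbK.
  rewrite -(zvarK x) neq_ltn -upN in xm.
  by case/orP: xm => h; [exists (~~ zsign x)|exists (zsign x)]; exists (zvertex x).
have third a c : ~~ supported_on m a c ->
    exists v, [/\ v != a, v != c & exists t, (0 < m (zvar t v))%N].
  rewrite negb_forall => /existsP[v]; rewrite negb_imply -andbA => /and3P[va vb].
  rewrite /vdeg -lt0n addn_gt0 => mv; exists v; split=> //.
  by case/orP: mv; [exists true | exists false].
have sup' a c : supported_on m a c = supported_on m' a c.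
  by apply: eq_forallb => v; rewrite eqV.
have [/existsP[j /andP[ji uj]]|noj] := boolP [exists j, (j != i) && up s j].
  by apply: (edge s j i).
have {}noj v : v != i -> ~~ up s v.
  by move=> vi; apply: contra noj => uv; apply/existsP; exists v; rewrite vi.
have [/existsP[j /andP[ji uj]]|nok] := boolP [exists j, (j != i) && up (~~ s) j].
  have nsup : ~~ supported_on m i j.
    apply/negP => sup; have sup2 : supported_on m j i.
      by apply/forallP => v; rewrite andbC; apply: (forallP sup).
    case: s ui uj {noj edge} => ui uj.
      have := eqL i j; rewrite /local_inv -sup' sup eq_sym ji.
      by move: ui uj; rewrite /up /=; lia.
    have := eqL j i; rewrite /local_inv -sup' sup2 ji.
    by move: ui uj; rewrite /up /=; lia.
  have [k [ki kj [t mt]]] := third _ _ nsup.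
  have [uk|nuk] := boolP (up (~~ s) k); first by apply: (edge (~~ s) k j).
  have mk b : m (zvar b k) = m' (zvar b k).
    by apply: not_up => -[]; case: (s) nuk (noj k ki).
  exists ((Z s i + Z (~~ s) j + Z t k)%MM, (Z (~~ s) i + Z s j + Z t k)%MM).
    by apply: flip_even => //; rewrite eq_sym.
  apply: conformalP => b v /=; rewrite !mnmDE !mnm1_zvar.
  have ui' := upP _ _ ui; have uj' := upP _ _ uj; rewrite negbK in uj'.
  rewrite /up in ui uj.
  have := mk t.
  have [kv|_] := eqVneq k v.
    rewrite -kv [i == k]eq_sym [j == k]eq_sym (negPf ki) (negPf kj) !andbF !add0n.
    by have [<-|] := eqVneq t b; rewrite /= ?subnn ?leq0n //; lia.
  rewrite !andbF !addn0.
  have [iv|_] := eqVneq i v; have [jv|_] := eqVneq j v.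
  - by move: ji; rewrite iv jv eqxx.
  - rewrite -iv; case: s ui ui' {uj uj' noj nuk}; case: b => /=; lia.
  - rewrite -jv; case: s uj uj' {ui ui' noj nuk}; case: b => /=; lia.
  - by rewrite !andbF.
have same v : v != i -> forall b, m (zvar b v) = m' (zvar b v).
  move=> vi; apply: not_up => b.
  have nuk : ~~ up (~~ s) v.
    by apply: contra nok => uv; apply/existsP; exists v; rewrite vi.
  by case: b (s) nuk (noj v vi) => -[].
have nsup a : ~~ supported_on m i a.
  apply/negP => sup; have := eqL i a; rewrite /local_inv -sup' sup.
  have [<-|ai] := eqVneq i a.
    by move: ui (eqV i); rewrite /up /vdeg; case: (s) => /=; lia.
  rewrite (same a) 1?eq_sym //.
  by move: ui (eqV i); rewrite /up /vdeg; case: (s) => /=; lia.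
(* The excess at i is odd only if the parities of the y-degrees differ. *)
have two : (m' (zvar s i) + 2 <= m (zvar s i))%N.
  have : odd (m (zvar false i)) = odd (m' (zvar false i)).
    move: eqY; rewrite /ydeg_odd (bigD1 i) //= [in RHS](bigD1 i) //= !oddD.
    by rewrite (eq_bigr (fun v => m' (zvar false v))) => [|v vi];
      [apply: addIb | apply: same].
  by move: ui (eqV i); rewrite /up /vdeg; case: (s) => /=; lia.
have [k [ki _ [t mt]]] := third _ _ (nsup i).
have [l [li lk [r mr]]] := third _ _ (nsup k).
exists ((Z s i + Z s i + (Z t k + Z r l))%MM,
        (Z (~~ s) i + Z (~~ s) i + (Z t k + Z r l))%MM); first exact: flip_odd.
apply: conformalP => b v /=; rewrite !mnmDE !mnm1_zvar.
have [iv|vi] := eqVneq i v.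
  rewrite -iv (negPf ki) (negPf li) !andbF !addn0.
  move: two (eqV i); rewrite /vdeg; case: (s); case: b => /=; lia.
rewrite !andbF !add0n -(same v) 1?eq_sym // !subnn !leq0n !andbT andbb.
have [kv|_] := eqVneq k v.
  rewrite (_ : l == v = false) ?andbF ?addn0; last by rewrite -kv (negPf lk).
  by rewrite -kv; have [<-|] := eqVneq t b; rewrite /= ?leq0n.
rewrite andbF add0n; have [<-|_] := eqVneq l v; last by rewrite andbF.
by have [<-|] := eqVneq r b; rewrite /= ?leq0n.
Qed.

End SignedVariables.

(** * Coefficient sums over the fibres of an invariant *)

Lemma subm_eq0 N (m p : 'X_{1..N}) : (m - p == 0)%MM = (m <= p)%MM.
Proof.
apply/eqP/mnm_lepP => [/mnmP mp0 x|mp].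
  by rewrite -subn_eq0 -mnmBE mp0 mnm0E.
by apply/mnmP => x; rewrite mnmBE mnm0E; apply/eqP; rewrite subn_eq0.
Qed.

Lemma lem_mdeg_eq N (m p : 'X_{1..N}) : (m <= p)%MM -> mdeg m = mdeg p -> m = p.
Proof.
move=> /submK pm; rewrite -{1}pm mdegD => deg_m.
have /eqP : mdeg (p - m)%MM = 0%N by lia.
by rewrite mdeg_eq0 -{2}pm => /eqP ->; rewrite add0m.
Qed.

Section ClassSum.
Variables (F : fieldType) (N : nat) (T : eqType) (phi : 'X_{1..N} -> T).
Implicit Types (f g : {mpoly F[N]}) (m p : 'X_{1..N}).

(** The degree bound makes the range of summation independent of f, so that
    linearity in f is immediate. *)
Definition class_sum d c f : F := \sum_(m : 'X_{1..N < d} | phi m == c) f@_m.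

Lemma class_sum_sum d c (J : eqType) (s : seq J) (f : J -> {mpoly F[N]}) :
  class_sum d c (\sum_(j <- s) f j) = \sum_(j <- s) class_sum d c (f j).
Proof.
rewrite /class_sum exchange_big /=.
by apply: eq_bigr => m _; rewrite raddf_sum.
Qed.

Lemma class_sumB d c f g :
  class_sum d c (f - g) = class_sum d c f - class_sum d c g.
Proof. by rewrite /class_sum -sumrB; apply: eq_bigr => m _; rewrite mcoeffB. Qed.

Lemma class_sumZ d c a f : class_sum d c (a *: f) = a * class_sum d c f.
Proof. by rewrite /class_sum mulr_sumr; apply: eq_bigr => m _; rewrite mcoeffZ. Qed.

Lemma class_sumX d c m :
  class_sum d c 'X_[m] = ((mdeg m < d)%N && (phi m == c))%:R.
Proof.
rewrite /class_sum; case: (ltnP (mdeg m) d) => [dm|dm] /=; last first.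
  rewrite big1 // => p _; rewrite mcoeffX; case: eqP => // mp.
  by have := bmdeg p; rewrite -mp ltnNge dm.
case: eqP => [mc|mc].
  rewrite (bigD1 (BMultinom dm)) /=; last exact/eqP.
  rewrite mcoeffX eqxx big1 ?addr0 // => p /andP[_ ne].
  by rewrite mcoeffX; case: eqP => // mp; case/eqP: ne; apply/val_inj.
rewrite big1 // => p /eqP pc; rewrite mcoeffX; case: eqP => // mp.
by case: mc; rewrite mp.
Qed.

(** The ideal is spanned by monomial multiples of the generators, each of which is a
    difference of two monomials of equal degree in one fibre. *)
Lemma class_sum_ideal_gen (A : {mpoly F[N]} -> Prop) :
  (forall f, A f -> exists p q, [/\ f = 'X_[p] - 'X_[q], mdeg p = mdeg q
     & forall r, phi (p + r)%MM = phi (q + r)%MM]) ->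
  forall f, ideal_gen A f -> forall d c, class_sum d c f = 0.
Proof.
move=> HA _ [s [As ->]] d c; rewrite class_sum_sum big_seq big1 // => -[h g] /As.
move=> /HA[p [q [/= -> pq phipq]]]; rewrite [h]mpolyE mulr_suml class_sum_sum.
rewrite big1 // => r _; rewrite -scalerAl class_sumZ mulrBr class_sumB.
rewrite -!mpolyXD !class_sumX !mdegD pq ![(r + _)%MM]addmC phipq subrr.
by rewrite mulr0.
Qed.

Lemma class_mate f m : (forall d c, class_sum d c f = 0) -> m \in msupp f ->
  exists m', [/\ m' \in msupp f, m' != m & phi m' = phi m].
Proof.
move=> f0 mf; have dm : (mdeg m < (mdeg m).+1)%N by [].
have := f0 (mdeg m).+1 (phi m).
rewrite /class_sum (bigD1 (BMultinom dm)) //= => sum0.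
have [/existsP[m' /and3P[h1 h2 h3]]|] :=
    boolP [exists m' : 'X_{1..N < (mdeg m).+1},
      [&& phi m' == phi m, m' != BMultinom dm & bmnm m' \in msupp f]].
  by exists m'; split=> //; apply/eqP.
rewrite negb_exists => /forallP H; move: sum0; rewrite big1 => [/eqP|m' /andP[h1 h2]].
  by rewrite addr0 mcoeff_eq0 mf.
by have := H m'; rewrite h1 h2 /= => /memN_msupp_eq0.
Qed.

End ClassSum.

(** * Congruence modulo the parity binomial edge ideal *)

Section ParityIdeal.
Variables (F : fieldType) (n : nat).
Local Notation I := (@parity_edge_ideal F n (@complete_graph n)).
Local Notation Z s i := (U_(zvar s i))%MM.
Implicit Types (i j k l : 'I_n) (s t : bool) (m p : 'X_{1..n + n}).

Lemma parity_ideal : is_ideal I. Proof. exact: is_ideal_gen. Qed.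
Local Notation idI := parity_ideal.

Lemma congr_edge s i j : i != j ->
  mnm_congr I (Z s i + Z s j)%MM (Z (~~ s) i + Z (~~ s) j)%MM.
Proof.
move=> ij; suff H : mnm_congr I (Z true i + Z true j)%MM (Z false i + Z false j)%MM.
  by case: s => //; apply: (mnm_congr_sym idI).
by apply: sub_ideal_gen; exists i, j; split=> //; rewrite !mpolyXD.
Qed.

Lemma congr_edgeD s i j r p q : i != j ->
    (Z s i + Z s j + r = p)%MM -> (Z (~~ s) i + Z (~~ s) j + r = q)%MM ->
  mnm_congr I p q.
Proof. by move=> ij <- <-; apply/(mnm_congrD idI)/congr_edge. Qed.

Ltac mnm_ac := apply/mnmP => ?; rewrite !mnmDE /=; lia.

(** Two edge flips through k: one uses up the letter at k and the other restores
    it; which of i and j comes first depends on that letter. *)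
Lemma congr_even s i j t k : i != j -> k != i -> k != j ->
  mnm_congr I (Z s i + Z (~~ s) j + Z t k)%MM (Z (~~ s) i + Z s j + Z t k)%MM.
Proof.
move=> ij ki kj.
have [->|/negPf tNs] := eqVneq t s.
  apply: (mnm_congr_trans idI
            (p := (Z (~~ s) i + Z (~~ s) j + Z (~~ s) k)%MM)).
    by apply: (@congr_edgeD s k i (Z (~~ s) j)) => //; mnm_ac.
  apply: (@congr_edgeD (~~ s) k j (Z (~~ s) i)) => //; rewrite ?negbK; mnm_ac.
have -> : t = ~~ s by case: (s) (t) tNs => -[].
apply: (mnm_congr_trans idI (p := (Z s i + Z s j + Z s k)%MM)).
  by apply: (@congr_edgeD (~~ s) k j (Z s i)) => //; rewrite ?negbK; mnm_ac.
by apply: (@congr_edgeD s k i (Z s j)) => //; mnm_ac.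
Qed.

(** An even flip of i against k in the context l, and an edge flip of i and k. *)
Lemma congr_odd s i t k r l : k != i -> l != i -> l != k ->
  mnm_congr I (Z s i + Z s i + (Z t k + Z r l))%MM
              (Z (~~ s) i + Z (~~ s) i + (Z t k + Z r l))%MM.
Proof.
move=> ki li lk.
have ev u : mnm_congr I (Z s i + Z (~~ s) k + Z r l + Z u i)%MM
    (Z (~~ s) i + Z s k + Z r l + Z u i)%MM.
  by apply/(mnm_congrD idI)/congr_even => //; rewrite eq_sym.
have [->|/negPf tNs] := eqVneq t s.
  apply: (mnm_congr_trans idI
            (p := (Z s i + Z (~~ s) k + Z r l + Z (~~ s) i)%MM)).
    by apply: (@congr_edgeD s k i (Z s i + Z r l)%MM) => //; mnm_ac.
  rewrite (_ : (_ + (Z s k + Z r l))%MM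
             = (Z (~~ s) i + Z s k + Z r l + Z (~~ s) i)%MM) //; mnm_ac.
have -> : t = ~~ s by case: (s) (t) tNs => -[].
rewrite (_ : (Z s i + Z s i + _)%MM
           = (Z s i + Z (~~ s) k + Z r l + Z s i)%MM); last by mnm_ac.
apply: (mnm_congr_trans idI (ev s)).
by apply: (@congr_edgeD s k i (Z (~~ s) i + Z r l)%MM) => //; mnm_ac.
Qed.

Lemma flip_congr p p' : flip p p' -> mnm_congr I p p'.
Proof.
by case=> *; [apply: congr_edge | apply: congr_even | apply: congr_odd].
Qed.

Lemma class_sum_parity f d c : I f -> class_sum (@mnm_inv n) d c f = 0.
Proof.
move=> If; move: f If d c; apply: class_sum_ideal_gen.
move=> _ [i [j [ij ->]]]; exists (Z true i + Z true j)%MM, (Z false i + Z false j)%MM.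
split; first by rewrite !mpolyXD.
  by rewrite !mdegD !mdeg1.
by move=> r; apply: mnm_inv_edge.
Qed.

Lemma mnm_inv_mdeg m p : mnm_inv m = mnm_inv p -> mdeg m = mdeg p.
Proof.
by move=> /eqP/mnm_invP[E _ _]; rewrite !mdeg_vdeg; apply: eq_bigr.
Qed.

Lemma congr_mnm_inv m p : mnm_congr I m p -> mnm_inv m = mnm_inv p.
Proof.
move=> mp; pose d := (maxn (mdeg m) (mdeg p)).+1.
have /eqP := class_sum_parity d (mnm_inv m) mp.
rewrite class_sumB !class_sumX !ltnS leq_maxl leq_maxr eqxx /= subr_eq0.
by case: (mnm_inv p =P mnm_inv m) => // _; rewrite oner_eq0.
Qed.

(** Each conformal flip shortens the distance, measured by the degree of the
    truncated difference m - p. *)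
Lemma mnm_inv_congr m p : mnm_inv m = mnm_inv p -> mnm_congr I m p.
Proof.
elim: {m}(mdeg (m - p)) {-2}m (leqnn (mdeg (m - p))) => [|d IH] m dmp E.
  rewrite (lem_mdeg_eq _ (mnm_inv_mdeg E)); first exact: (mnm_congr_refl idI).
  by rewrite -subm_eq0 -mdeg_eq0 -leqn0.
have [->|ne] := eqVneq m p; first exact: (mnm_congr_refl idI).
have [[q q'] /= fl /and4P[qm q'p c1 c2]] := exists_conformal_flip E ne.
pose m1 := (m - q + q')%MM.
have mm1 : mnm_congr I m m1.
  rewrite -{1}(submK qm) /m1 ![(m - q + _)%MM]addmC.
  exact/(mnm_congrD idI)/flip_congr.
apply: (mnm_congr_trans idI mm1); apply: IH; last by rewrite -E (congr_mnm_inv mm1).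
(* Conformality makes the truncated differences additive. *)
have mpE : (m - p = (m1 - p) + (q - q'))%MM.
  apply/mnmP => x; rewrite /m1 !(mnmBE, mnmDE).
  move: (mnm_lepP qm x) (mnm_lepP q'p x) (mnm_lepP c1 x) (mnm_lepP c2 x).
  rewrite !mnmBE; lia.
have : (0 < mdeg (q - q'))%N.
  rewrite lt0n mdeg_eq0 subm_eq0; apply: contra (flip_neq fl) => qq'.
  by apply/eqP/lem_mdeg_eq => //; case: (flip_mdeg fl).
by move: dmp; rewrite mpE mdegD; lia.
Qed.

Lemma congrP m p : reflect (mnm_congr I m p) (mnm_inv m == mnm_inv p).
Proof. by apply: (iffP eqP) => [/mnm_inv_congr|/congr_mnm_inv]. Qed.

Lemma parity_pure_difference : pure_difference I.
Proof.
split=> [|f m If mf]; first exact: idI.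
have [m' [m'f ne E]] := class_mate (fun d c => class_sum_parity d c If) mf.
by exists m'; split=> //; apply/congrP/eqP.
Qed.

Lemma flip_cover m m' : mnm_congr I m m' -> m != m' ->
  exists p p', [/\ flip p p', (p <= m)%MM & (p' <= m')%MM].
Proof.
move=> /congrP/eqP E /(exists_conformal_flip E)[[p p'] fl /and4P[pm pm' _ _]].
by exists p, p'.
Qed.

Lemma graver_flip f : graver_basis I f ->
  exists m m', flip m m' /\ f = 'X_[m] - 'X_[m'].
Proof.
move=> [m [m' [[[ne mm'] prim] ->]]]; exists m, m'; split=> //.
have [p [p' [fl pm pm']]] := flip_cover mm' ne.
have [[<- <-] //|ne'] := eqVneq (p, p') (m, m').
case: prim; exists p, p'; split=> //; split; first exact: flip_neq.
exact: flip_congr.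
Qed.

End ParityIdeal.

(** * Weight orders and flips in reduced bases *)

Section WeightOrder.
Variables (N : nat) (w : 'I_N -> nat).
Implicit Types (m p : 'X_{1..N}).

Definition weight m : nat := (\sum_x w x * m x)%N.

Lemma weightD m p : weight (m + p)%MM = (weight m + weight p)%N.
Proof.
rewrite /weight -big_split /=; apply: eq_bigr => x _.
by rewrite mnmDE mulnDr.
Qed.

Lemma weight1 x : weight U_(x)%MM = w x.
Proof.
rewrite /weight (bigD1 x) //= mnm1E eqxx muln1 big1 ?addn0 // => y yx.
by rewrite mnm1E eq_sym (negPf yx) muln0.
Qed.

Lemma weight0 : weight 0%MM = 0%N.
Proof. by rewrite /weight big1 // => x _; rewrite mnm0E muln0. Qed.

(** The graded lexicographic order breaks ties. *)
Definition weight_le : rel 'X_{1..N} := fun m p =>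
  (weight m < weight p)%N || (weight m == weight p) && (m <= p)%O.

Lemma weight_leW m p : (weight m < weight p)%N -> weight_le m p.
Proof. by rewrite /weight_le => ->. Qed.

Lemma weight_le_morder : monomial_order weight_le.
Proof.
rewrite /weight_le; split.
- split=> [m|m p]; first by rewrite eqxx lexx orbT.
  by case: ltngtP => //= _ /le_anti.
- move=> p m q; case: (ltngtP (weight m) (weight p)) => //= [lt _|e mp].
    by case: (ltngtP (weight p)) => //= [lt' _|<-]; rewrite ?lt ?(ltn_trans lt lt').
  by rewrite e; case: ltngtP => //= _; apply: le_trans.
- by move=> m p; case: ltngtP => //= _; apply: le_total.
- by move=> m; rewrite weight0 le0x andbT; case: (weight m).
- by move=> m p q; rewrite !weightD ltn_add2r eqn_add2r lemc_add2l.
Qed.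

End WeightOrder.

Section FlipInUniversal.
Variables (F : fieldType) (n : nat).
Local Notation I := (@parity_edge_ideal F n (@complete_graph n)).
Local Notation Z s i := (U_(zvar s i))%MM.
Implicit Types (i j k l : 'I_n) (s t : bool) (m p q : 'X_{1..n + n}).

Let eqv : rel 'X_{1..n + n} := fun m p => mnm_inv m == mnm_inv p.
Let eqvP : forall m p, reflect (mnm_congr I m p) (eqv m p) := @congrP F n.

Section FavouredSigns.
Variables (e : 'I_n -> bool) (h : 'I_n -> nat).

(** At each vertex i the letter e i is free and the other one costs h i. *)
Definition cost s i : nat := if s == e i then 0%N else h i.
Definition sign_weight (x : 'I_(n + n)) : nat := cost (zsign x) (zvertex x).
Let le := weight_le sign_weight.
Let mo : monomial_order le := weight_le_morder sign_weight.

Lemma weight_zvar s i : weight sign_weight (Z s i) = cost s i.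
Proof. by rewrite weight1 /sign_weight zsignE zvertexE. Qed.

(** The premises say that every flip whose source divides q increases the weight.
    An edge flip of (s, i), (s, j) and an even flip of (s, i), (~~ s, j) change
    the weight in the same way, hence the common premise on pairs; degrees of
    q rule out the flips with too large a source. *)
Lemma standard_of_costs q :
    (forall s i t j, i != j -> (0 < q (zvar s i))%N -> (0 < q (zvar t j))%N ->
       (1 < mdeg q)%N -> (s == t) || (2 < mdeg q)%N ->
       (cost s i + cost t j < cost (~~ s) i + cost (~~ t) j)%N) ->
    (forall s i, (1 < q (zvar s i))%N -> (3 < mdeg q)%N ->
       (cost s i < cost (~~ s) i)%N) ->
  standard eqv le q.
Proof.
move=> Hpair Hsq.
apply: (standard_of_moves (parity_pure_difference F n) eqvP _ _ _ _ mo
          (R := @flip n)) => [m p /eqP /mnm_inv_mdeg //|||m m'|p p' fl pq].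
- exact: flip_congr.
- exact: flip_neq.
- exact: flip_cover.
apply: weight_leW; have dq : (mdeg p <= mdeg q)%N.
  by rewrite -(submK pq) mdegD leq_addl.
have qx x : (p x <= q x)%N by apply/mnm_lepP.
case: fl pq dq qx => [s i j ij|s i j t k ij ki kj|s i t k r l ki li lk] _;
  rewrite !mdegD !mdeg1 !weightD !weight_zvar => dq qx.
- apply: Hpair; rewrite ?eqxx //.
    by apply: leq_trans (qx _); rewrite mnmDE mnm1E eqxx.
  by apply: leq_trans (qx _); rewrite mnmDE [X in (_ + X)%N]mnm1E eqxx addn1.
- rewrite ltn_add2r -{4}[s]negbK; apply: Hpair; rewrite ?(ltnW dq) ?dq ?orbT //.
    by apply: leq_trans (qx _); rewrite !mnmDE mnm1E eqxx.
  apply: leq_trans (qx _); rewrite !mnmDE [X in (_ + X + _)%N]mnm1E eqxx.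
  by rewrite addn1.
- have : (cost s i < cost (~~ s) i)%N.
    apply: Hsq => //; apply: leq_trans (qx _).
    by rewrite !mnmDE !mnm1E eqxx.
  by lia.
Qed.

(** The target m' uses free letters only, so no flip can decrease its weight,
    and positive costs make the change strict.  The proper divisors of m have degree less than that of m, which leaves for them
    only the flips of smaller degree than the given one. *)
Lemma flip_in_universal_of_costs m m' : flip m m' ->
    (forall s i, (0 < m' (zvar s i))%N -> s = e i) ->
    (forall s i, (1 < m' (zvar s i))%N -> (0 < h i)%N) ->
    (forall i j, i != j -> (0 < h i + h j)%N) ->
    (forall s i t j, i != j -> (0 < m (zvar s i))%N -> (0 < m (zvar t j))%N ->
       (2 < mdeg m)%N -> (s == t) || (3 < mdeg m)%N ->
       (cost s i + cost t j < cost (~~ s) i + cost (~~ t) j)%N) ->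
  universal_groebner_basis I ('X_[m] - 'X_[m']).
Proof.
move=> fl fav sq pos pair.
have [_ dm] := flip_mdeg fl.
apply: (binomial_in_universal (parity_pure_difference F n) eqvP _ _ _ _ _ mo
          (R := @flip n) (D := 5)) => [p q /eqP /mnm_inv_mdeg //|||p p' /flip_mdeg[]//|p p'||||x mx].
- exact: flip_congr.
- exact: flip_neq.
- exact: flip_cover.
- exact: flip_congr.
- exact: flip_neq.
- apply: standard_of_costs => [s i t j ij /fav si /fav tj _ _|s i m2 _].
    rewrite /cost si tj !eqxx; have := pos _ _ ij.
    by case: (e i); case: (e j).
  by have := sq _ _ m2; rewrite /cost -(fav s i (ltnW m2)) eqxx; case: (s).
have Ux : (U_(x) <= m)%MM by rewrite lep1mP -lt0n.
have deg_m : (mdeg m = mdeg (m - U_(x)) + 1)%N by rewrite -{1}(submK Ux) mdegD mdeg1.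
have sub y : (0 < (m - U_(x))%MM y)%N -> (0 < m y)%N.
  by rewrite mnmBE => H; apply: leq_trans H (leq_subr _ _).
apply: standard_of_costs => [s i t j ij /sub si /sub tj m2 st|s i _]; last by lia.
by apply: pair => //; [lia | case/orP: st => [->//|]; lia].
Qed.

End FavouredSigns.

Lemma mnm1_gt0 s i t j : (0 < Z s i (zvar t j))%N -> t = s /\ j = i.
Proof. by rewrite mnm1_zvar lt0b => /andP[/eqP -> /eqP ->]. Qed.

(** In each case the letters of the target are free.  For an edge flip all costs
    can be one.  For an even flip the cost 1 at i against 0 at j makes the source
    heavier, and 3 at k exceeds both together.  For an odd flip the cost
    at k and l exceeds that at i, so that among the letters of the source every
    pair at distinct vertices gains weight when flipped. *)
Lemma flip_in_universal m m' : flip m m' ->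
  universal_groebner_basis I ('X_[m] - 'X_[m']).
Proof.
move=> fl; case: (fl) => [s i j ij|s i j t k ij ki kj|s i t k r l ki li lk].
- apply: (@flip_in_universal_of_costs (fun=> ~~ s) (fun=> 1%N)) => //.
  + exact: flip_edge.
  + by move=> b v; rewrite mnmDE addn_gt0 => /orP[]/mnm1_gt0[-> _].
  + by move=> b v b' v' _ _ _; rewrite mdegD !mdeg1.
- pose e v := if v == i then ~~ s else if v == j then s else t.
  pose h v := if v == i then 1%N else if v == j then 0%N else 3%N.
  have ji : j != i by rewrite eq_sym.
  have [ei ej ek] : [/\ e i = ~~ s, e j = s & e k = t].
    by rewrite /e eqxx (negPf ji) eqxx (negPf ki) (negPf kj).
  have [hi hj hk] : [/\ h i = 1%N, h j = 0%N & h k = 3%N].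
    by rewrite /h eqxx (negPf ji) eqxx (negPf ki) (negPf kj).
  apply: (@flip_in_universal_of_costs e h) => //.
  + exact: flip_even.
  + move=> b v; rewrite !mnmDE !addn_gt0.
    by move=> /orP[/orP[]|]/mnm1_gt0[-> ->].
  + move=> b v; rewrite !mnmDE !mnm1_zvar.
    have [<-|_] := eqVneq i v; first by rewrite hi.
    have [<-|_] := eqVneq j v; first by rewrite (negPf kj) !andbF; case: (_ && _).
    by rewrite !andbF; case: (_ && _).
  + move=> a b ab; rewrite /h; have [ai|_] := eqVneq a i; first by [].
    have [aj|_] := eqVneq a j; last by [].
    by have [//|_] := eqVneq b i; have [bj|//] := eqVneq b j; rewrite aj bj eqxx in ab.
  + move=> b v b' v'; rewrite !mnmDE !addn_gt0 !mdegD !mdeg1 orbF /cost.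
    move=> vv' /orP[/orP[]|]/mnm1_gt0[eb ev] /orP[/orP[]|]/mnm1_gt0[eb' ev'] _ /eqP;
      move: vv'; rewrite {}ev {}ev' ?eqxx // => _ bb'; move: bb' eb eb' => <- -> {b b'};
      rewrite ?ei ?ej ?ek ?hi ?hj ?hk; by case: (s); case: (t).
- pose e v := if v == i then ~~ s else if v == k then t else r.
  pose h v := if v == i then 1%N else 2%N.
  have [ei ek el] : [/\ e i = ~~ s, e k = t & e l = r].
    by rewrite /e eqxx (negPf ki) eqxx (negPf li) (negPf lk).
  have [hi hk hl] : [/\ h i = 1%N, h k = 2%N & h l = 2%N].
    by rewrite /h eqxx (negPf ki) (negPf li).
  have hpos v : (0 < h v)%N by rewrite /h; case: ifP.
  apply: (@flip_in_universal_of_costs e h) => //.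
  + exact: flip_odd.
  + move=> b v; rewrite !mnmDE !addn_gt0.
    by move=> /orP[/orP[]|/orP[]]/mnm1_gt0[-> ->].
  + by move=> a b _; rewrite addn_gt0 hpos.
  + move=> b v b' v'; rewrite !mnmDE !addn_gt0 !orbb /cost.
    move=> vv' /orP[|/orP[]]/mnm1_gt0[-> ev] /orP[|/orP[]]/mnm1_gt0[-> ev'] _ _;
      move: vv'; rewrite {}ev {}ev' ?eqxx // => _;
      rewrite ?ei ?ek ?el ?hi ?hk ?hl; by case: (s); case: (t); case: (r).
Qed.

End FlipInUniversal.

(** * Minimal paths in the complete graph *)

Section CompletePaths.
Variable n : nat.
Local Notation K := (@complete_graph n).
Implicit Types (i j k l v w : 'I_n) (p q : seq 'I_n).

(** Such a path alternates between v and w. *)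
Lemma two_vertex_path v w p : path K v p -> {subset p <= [:: v; w]} ->
  last v p = if odd (size p) then w else v.
Proof.
elim: p v w => [|u p IH] v w //= /andP[vu pth] sub.
have uw : u = w.
  have := sub u; rewrite !inE eqxx => /(_ isT) /orP[/eqP uv|/eqP //].
  by rewrite /complete_graph uv eqxx in vu.
rewrite {u}uw in vu pth sub *; rewrite (IH _ v) // => [|x xp]; first by case: odd.
by have := sub x; rewrite !inE xp orbT => /(_ isT); rewrite orbC.
Qed.

Lemma is_path_last (U : {set 'I_n}) v w p : is_path K U v w p ->
  [/\ {subset v :: p <= U}, path K v p & last v p = w].
Proof. by case/and3P => /allP sub pth /eqP. Qed.

(** An interior vertex avoided by q could be removed. *)
Lemma minimal_path_interior_sub i j p q : minimal_path K i j p ->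
    path K i q -> last i q = j -> odd (size q) = odd (size p) ->
    {subset q <= i :: p} ->
  forall x, x \in interior i j p -> x \in q.
Proof.
move=> [_ min1 _] pq lq par sub x xint; apply: contraPT (min1 x xint) => xq.
case; exists q; split; last by rewrite /same_parity par.
apply/and3P; split=> //; last exact/eqP.
apply/allP => y yq; rewrite !inE.
have -> /= : y != x.
  move: xint yq; rewrite !inE negb_or => /andP[/andP[xi _] _] /orP[/eqP ->|yq].
    by rewrite eq_sym.
  by apply: contraNneq xq => <-.
by move: yq; rewrite inE => /orP[->//|/sub]; rewrite inE.
Qed.

Lemma mem_interior i j p x :
  (x \in interior i j p) = [&& x != i, x != j & x \in p].
Proof. by rewrite !inE negb_or -andbA; case: (x == i). Qed.

(** The edge i j avoids the whole interior. *)
Lemma odd_minimal_path_interior i j p : i != j -> odd (size p) ->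
  minimal_path K i j p -> interior i j p = set0.
Proof.
move=> ij po mp; have [pth _ _] := mp; have [_ _ lp] := is_path_last pth.
have jp : j \in p by case: (p) po lp => //= a s _ <-; apply: mem_last.
apply/eqP; rewrite -subset0; apply/subsetP => x xint.
have := minimal_path_interior_sub mp (q := [:: j]) _ (erefl j) _ _ xint.
rewrite /= /complete_graph ij po inE => /(_ isT erefl) H.
have /eqP xj : x == j.
  by apply: H => y; rewrite !inE => /eqP ->; rewrite jp orbT.
by move: xint; rewrite mem_interior xj eqxx andbF.
Qed.

(** A path on i and j alone would be odd; and one interior vertex k suffices, by
    the path i k j. *)
Lemma even_minimal_path_interior i j p : i != j -> ~~ odd (size p) ->
    minimal_path K i j p ->
  exists k, [/\ k != i, k != j & interior i j p = [set k]].
Proof.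
move=> ij po mp; have [pth _ _] := mp; have [_ pK lp] := is_path_last pth.
have jp : j \in p.
  by case: (p) lp => [/= e|a s /= <-]; [rewrite e eqxx in ij | apply: mem_last].
have [k kint] : exists k, k \in interior i j p.
  apply/set0Pn; apply: contraNneq ij => int0; rewrite -lp.
  rewrite (two_vertex_path (w := j) pK) ?(negPf po) // => x xp; rewrite !inE.
  by have := in_set0 x; rewrite -int0 mem_interior xp andbT -negb_or => /negbFE.
have := kint; rewrite mem_interior => /and3P[ki kj kp].
exists k; split=> //; apply/eqP; rewrite eqEsubset sub1set kint andbT.
apply/subsetP => x xint.
have := minimal_path_interior_sub mp (q := [:: k; j]) _ (erefl j) _ _ xint.
rewrite /= /complete_graph eq_sym ki kj (negPf po) => /(_ isT erefl) H.
move: xint; rewrite mem_interior => /and3P[xi xj xp].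
have := H _; rewrite !inE (negPf xj) orbF; apply.
by move=> y; rewrite !inE => /orP[]/eqP ->; rewrite ?kp ?jp orbT.
Qed.

(** A closed path on two vertices is even, so an odd one has two interior
    vertices; two suffice, by the triangle i k l i. *)
Lemma odd_minimal_closed_path_interior i p : odd (size p) ->
    minimal_path K i i p ->
  exists k l, [/\ k != i, l != i, l != k & interior i i p = [set k; l]].
Proof.
move=> po mp; have [pth _ _] := mp; have [_ pK lp] := is_path_last pth.
have [k [ki kp ik]] : exists k, [/\ k != i, k \in p & K i k].
  case: (p) po pK => //= k s _ /andP[ik _]; exists k.
  by rewrite eq_sym mem_head.
have [l [li lk lp']] : exists l, [/\ l != i, l != k & l \in p].
  have [/hasP[l lp' /norP[li lk]]|/hasPn all2] :=
      boolP (has (fun l => ~~ ((l == i) || (l == k))) p).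
    by exists l.
  case/eqP: ki; rewrite -[RHS]lp (two_vertex_path (w := k) pK) ?po // => x xp.
  by rewrite !inE -[_ || _]negbK all2.
exists k, l; split=> //; apply/setP => x; rewrite !inE.
apply/idP/idP => [xint|/orP[]/eqP ->]; last 2 first.
- by rewrite (negPf ki) kp.
- by rewrite (negPf li) lp'.
have xint' : x \in interior i i p by rewrite !inE.
have := minimal_path_interior_sub mp (q := [:: k; l; i]) _ (erefl i) _ _ xint'.
rewrite /= ik /complete_graph [k == l]eq_sym lk li po => /(_ isT erefl) H.
move: xint'; rewrite mem_interior => /and3P[xi _ xp].
have := H _; rewrite !inE (negPf xi) orbF; apply.
by move=> y; rewrite !inE => /or3P[]/eqP ->; rewrite ?kp ?lp' ?eqxx ?orbT.
Qed.

Lemma interior_edge i j : interior i j [:: j] = set0.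
Proof. by apply/setP => x; rewrite mem_interior !inE; case: (x == j); rewrite ?andbF. Qed.

Lemma interior_even i j k : k != i -> k != j -> interior i j [:: k; j] = [set k].
Proof.
move=> ki kj; apply/setP => x; rewrite mem_interior !inE.
by have [->|_] := eqVneq x k; rewrite ?ki ?kj //=; case: (x == j); rewrite ?andbF.
Qed.

Lemma interior_odd i k l : k != i -> l != i ->
  interior i i [:: k; l; i] = [set k; l].
Proof.
move=> ki li; apply/setP => x; rewrite mem_interior !inE.
have [->|_] := eqVneq x k; first by rewrite ki.
by have [->|_] := eqVneq x l; rewrite ?li //=; case: (x == i).
Qed.

Lemma minimal_edge i j : i != j -> minimal_path K i j [:: j].
Proof.
move=> ij; split.
- by apply/and3P; split=> //=; [rewrite !inE | rewrite /complete_graph ij].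
- by move=> k; rewrite interior_edge inE.
- by case=> -[|x q] [_ sz]; rewrite /same_parity.
Qed.

Lemma minimal_even i j k : i != j -> k != i -> k != j ->
  minimal_path K i j [:: k; j].
Proof.
move=> ij ki kj; split.
- apply/and3P; split=> //=; first by rewrite !inE.
  by rewrite /complete_graph eq_sym ki kj.
- move=> x; rewrite interior_even // inE => /eqP -> [q [/is_path_last[sub pq lq] par]].
  case/eqP: ij; rewrite -lq (two_vertex_path (w := j) pq) ?(eqP par) // => y yq.
  by have := sub y; rewrite !inE yq orbT => /(_ isT) /andP[/negPf ->].
- case=> q [/is_path_last[_ _ lq] sz par _].
  by case: q lq sz par => [|a [|b q]] //= /eqP; rewrite (negPf ij).
Qed.

Lemma minimal_odd i k l : k != i -> l != i -> l != k ->
  minimal_path K i i [:: k; l; i].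
Proof.
move=> ki li lk; split.
- apply/and3P; split=> //=; first by rewrite !inE.
  by rewrite /complete_graph eq_sym ki eq_sym lk li.
- move=> x; rewrite interior_odd // !inE => xkl [q [/is_path_last[sub pq lq] par]].
  have [w wi qw] : exists2 w, w != i & {subset q <= [:: i; w]}.
    case/orP: xkl sub => /eqP -> sub; [exists l | exists k] => // y yq;
      have := sub y; rewrite !inE yq orbT => /(_ isT) /andP[/negPf -> /=].
      by rewrite orbA orbC orbA orbb.
    by case: (y == i); case: (y == k).
  by case/eqP: wi; rewrite -[RHS]lq (two_vertex_path pq qw) (eqP par).
- case=> q [/is_path_last[_ pq lq] sz par _].
  case: q pq lq sz par => [|a [|b [|c q]]] //= /andP[ia _] ai.
  by rewrite /complete_graph ai eqxx in ia.
Qed.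

End CompletePaths.

(** * Path binomials are flips *)

Section Conclusion.
Variables (F : fieldType) (n : nat).
Local Notation K := (@complete_graph n).
Local Notation I := (@parity_edge_ideal F n K).
Implicit Types (i j k l : 'I_n) (f : {mpoly F[n + n]}).

Lemma tprod_set0 t : tprod F (set0 : {set 'I_n}) t = 1.
Proof. by rewrite /tprod big_set0. Qed.

Lemma tprod_set1 k t : tprod F [set k] t = 'X_(zvar (t k) k).
Proof. by rewrite /tprod big_set1; case: (t k). Qed.

Lemma tprod_set2 k l t : l != k ->
  tprod F [set k; l] t = 'X_(zvar (t k) k) * 'X_(zvar (t l) l).
Proof.
move=> lk; rewrite /tprod big_setU1 ?inE 1?eq_sym // big_set1.
by case: (t k); case: (t l).
Qed.

Lemma minimal_path_flip f : minimal_path_binomials K f ->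
  exists m m', flip m m' /\ f = 'X_[m] - 'X_[m'].
Proof.
case=> -[i [j [p [mp [t]]]]] /=.
have [po|po] := ifP; last first.
  have [<- fE|ij -> _] := eqVneq i j.
    by rewrite fE mulrC mulrBr [yv _ _ * _]mulrC subrr eqxx.
  have [k [ki kj ->]] := even_minimal_path_interior ij (negbT po) mp.
  exists (U_(zvar true i) + U_(zvar (~~ true) j) + U_(zvar (t k) k))%MM.
  exists (U_(zvar (~~ true) i) + U_(zvar true j) + U_(zvar (t k) k))%MM.
  split; first exact: flip_even.
  by rewrite tprod_set1 mulrBl !mpolyXD.
move=> H _; have [ij|ij] := eqVneq i j; last first.
  rewrite (odd_minimal_path_interior ij po mp) tprod_set0 !mulr1 in H.
  have [s ->] : exists s, f = 'X_(zvar s i) * 'X_(zvar s j)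
                            - 'X_(zvar (~~ s) i) * 'X_(zvar (~~ s) j).
    by case: H => ->; [exists true | exists false].
  do 2!eexists; split; first exact: (flip_edge s ij).
  by rewrite !mpolyXD.
rewrite -{j}ij in mp H.
have [k [l [ki li lk intE]]] := odd_minimal_closed_path_interior po mp.
rewrite intE tprod_set2 // in H.
pose u : {mpoly F[n + n]} := 'X_(zvar (t k) k) * 'X_(zvar (t l) l).
have [s ->] : exists s, f = ('X_(zvar s i) * 'X_(zvar s i)
                          - 'X_(zvar (~~ s) i) * 'X_(zvar (~~ s) i)) * u.
  by case: H => ->; [exists true | exists false].
do 2!eexists; split; first exact: (flip_odd s (t k) (t l) ki li lk).
by rewrite !mpolyXD mulrBl.
Qed.

(** A flip of the letter y at i is realised by reversing the path if it is even and
    by the second sign choice if it is odd. *)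
Lemma flip_minimal_path m m' : flip m m' ->
  minimal_path_binomials K ('X_[m] - 'X_[m'] : {mpoly F[n + n]}).
Proof.
move=> fl; split; last exact/binomial_neq0/flip_neq.
case: fl => [s i j ij|s i j t k ij ki kj|s i t k r l ki li lk].
- exists i, j, [:: j]; split; first exact: minimal_edge.
  exists [ffun=> true] => /=; rewrite interior_edge tprod_set0 !mulr1 !mpolyXD.
  by case: s; [left | right].
- have Xt (a b : 'I_n) : k != a -> k != b ->
      tprod F (interior a b [:: k; b]) [ffun=> t] = 'X_(zvar t k).
    by move=> ka kb; rewrite interior_even // tprod_set1 ffunE.
  case: s.
    exists i, j, [:: k; j]; split; first exact: minimal_even.
    by exists [ffun=> t] => /=; rewrite Xt // !mpolyXD mulrBl.
  exists j, i, [:: k; i]; split; first by apply: minimal_even; rewrite // eq_sym.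
  exists [ffun=> t] => /=; rewrite Xt // !mpolyXD mulrBl.
  by congr (_ * _ - _ * _); apply: mulrC.
- exists i, i, [:: k; l; i]; split; first exact: minimal_odd.
  exists [ffun v => if v == k then t else r] => /=.
  rewrite interior_odd // tprod_set2 // !ffunE eqxx (negPf lk) !mulrBl !mpolyXD.
  by case: s; [left | right].
Qed.

End Conclusion.

Theorem theorem3p13 (F : fieldType) (n : nat) (hn : (1 <= n)%N) :
  (forall f : {mpoly F[n + n]},
     minimal_path_binomials (@complete_graph n) f <->
     universal_groebner_basis (parity_edge_ideal (@complete_graph n)) f) /\
  (forall f : {mpoly F[n + n]},
     universal_groebner_basis (parity_edge_ideal (@complete_graph n)) f <->
     graver_basis (parity_edge_ideal (@complete_graph n)) f).
Proof.
have UG (f : {mpoly F[n + n]}) :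
    universal_groebner_basis (parity_edge_ideal (@complete_graph n)) f ->
    graver_basis (parity_edge_ideal (@complete_graph n)) f.
  move=> [le [G [mo rG fG]]].
  exact: (reduced_in_graver (parity_pure_difference F n) mo rG).
split=> f; split.
- by move=> /minimal_path_flip[m [m' [fl ->]]]; apply: flip_in_universal.
- by move=> /UG/graver_flip[m [m' [fl ->]]]; apply: flip_minimal_path.
- exact: UG.
- by move=> /graver_flip[m [m' [fl ->]]]; apply: flip_in_universal.
Qed.
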